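(* In terms of the coordinates $(z,r,\sigma)\in\mathbb{R}^3\times(0,\infty)\times\mathbb{S}^2$, given by $v=z+r\sigma$, $w=z-r\sigma$, the lifted Landau collision operator $Q$ with potential $\alpha$ takes the form $$\bar Q(F)(z,r,\sigma)=\alpha(r)\,\Delta_\sigma\bar F(z,r,\sigma).$$ Consequently, the lifted equation $\partial_tF=Q(F)$ in $(0,\infty)\times\mathbb{R}^6$ is simply the heat equation with respect to $t$ and $\sigma$, with diffusion coefficient $\alpha(r)$, for each fixed $(z,r)$: $$\partial_t\bar F=\alpha(r)\,\Delta_\sigma\bar F.$$
   Context: $\mathbb{S}^2$ is the unit sphere in $\mathbb{R}^3$ and $\Delta_\sigma$ is its Laplace--Beltrami operator, acting in the variable $\sigma$ with the other variables fixed. The potential is a function $\alpha:(0,\infty)\to[0,\infty)$, and $$a_{ij}(y)=\alpha(|y|)\left(|y|^2\delta_{ij}-y_iy_j\right),\qquad i,j=1,2,3.$$ The lifted Landau collision operator acts on (sufficiently smooth) functions $F(v,w)$, $(v,w)\in\mathbb{R}^3\times\mathbb{R}^3=\mathbb{R}^6$, by $$Q(F)(v,w)=\sum_{i,j=1}^3(\partial_{v_i}-\partial_{w_i})\Big[a_{ij}(v-w)\,(\partial_{v_j}-\partial_{w_j})F(v,w)\Big].$$ A bar indicates a function expressed in the variables $(z,r,\sigma)$: $\bar F(z,r,\sigma)=F(z+r\sigma,z-r\sigma)$, $\bar Q(F)(z,r,\sigma)=Q(F)(z+r\sigma,z-r\sigma)$, and, for time-dependent $F$, $\bar F(t,z,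r,\sigma)=F(t,z+r\sigma,z-r\sigma)$.
   Formalization: With the stated conventions v−w=2rσ, so the coefficient α(r) is wrong in both formulas (try α=1, F=v₁−w₁) and is corrected to 4α(2r); α is assumed differentiable on (0,∞) so that Q(F) is defined, F is C² in (v,w), and the lifted equation is taken where v≠w. *)

(* Defs.v *)
From HB Require Import structures.
From mathcomp Require Import all_boot all_order all_algebra.
From mathcomp Require Import all_classical all_reals all_analysis.
Import Order.TTheory GRing.Theory Num.Theory.
Import numFieldNormedType.Exports.

Set Implicit Arguments.
Unset Strict Implicit.
Unset Printing Implicit Defensive.

Local Open Scope classical_set_scope.
Local Open Scope ring_scope.

(* [`|x|] on ['rV[R]_n] is the sup norm, hence a separate Euclidean norm. *)
Definition enorm (R : realType) (n : nat) (x : 'rV[R]_n) : R :=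
  Num.sqrt (\sum_(i < n) x 0 i ^+ 2).

Definition unit_sphere (R : realType) : set 'rV[R]_3 :=
  [set s | enorm s = 1].

Definition basis_vec (R : realType) (n : nat) (i : 'I_n) : 'rV[R]_n :=
  delta_mx 0 i.

(* In finite dimension, this is the usual class C^k. *)
Fixpoint Ck (R : realType) (V : normedModType R) (k : nat) (f : V -> R)
    : Prop :=
  if k is k'.+1 then
    (forall x, differentiable f x) /\ (forall v, Ck k' (fun x => 'D_v f x))
  else continuous f.

(* Only the values of [alpha] on ]0, +oo[ are meaningful: [a_coef alpha i j y]
   has no meaning at y = 0, and [lifted_Q] below has none on {v = w}. *)
Definition a_coef (R : realType) (alpha : R -> R) (i j : 'I_3)
    (y : 'rV[R]_3) : R :=
  alpha (enorm y) * (enorm y ^+ 2 * (i == j)%:R - y 0 i * y 0 j).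

Definition partial_v (R : realType) (i : 'I_3)
    (F : 'rV[R]_3 * 'rV[R]_3 -> R) (p : 'rV[R]_3 * 'rV[R]_3) : R :=
  'D_(basis_vec R i, 0) F p.

Definition partial_w (R : realType) (i : 'I_3)
    (F : 'rV[R]_3 * 'rV[R]_3 -> R) (p : 'rV[R]_3 * 'rV[R]_3) : R :=
  'D_(0, basis_vec R i) F p.

Definition partial_vw (R : realType) (i : 'I_3)
    (F : 'rV[R]_3 * 'rV[R]_3 -> R) (p : 'rV[R]_3 * 'rV[R]_3) : R :=
  partial_v i F p - partial_w i F p.

Definition lifted_Q (R : realType) (alpha : R -> R)
    (F : 'rV[R]_3 * 'rV[R]_3 -> R) (p : 'rV[R]_3 * 'rV[R]_3) : R :=
  \sum_(i < 3) \sum_(j < 3)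
    partial_vw i
      (fun q => a_coef alpha i j (q.1 - q.2) * partial_vw j F q) p.

Definition bar (R : realType) (F : 'rV[R]_3 * 'rV[R]_3 -> R)
    (z : 'rV[R]_3) (r : R) (s : 'rV[R]_3) : R :=
  F (z + r *: s, z - r *: s).

Definition normalize (R : realType) (x : 'rV[R]_3) : 'rV[R]_3 :=
  (enorm x)^-1 *: x.

(* Calculus on S^2 embedded in R^3 with the induced metric.  Functions and
   vector fields on S^2 are represented by functions on R^3; since they are
   precomposed with x |-> x / |x|, only their values on S^2 matter.  The
   extension f (x / |x|) is constant in the normal direction, so its Euclidean
   gradient at s in S^2 is the Riemannian gradient of f; likewise the Euclidean
   divergence of the extension of a tangent field X is the trace of the
   tangential part of dX, i.e. its Riemannian divergence. *)
Definition sphere_partial (R : realType) (i : 'I_3) (f : 'rV[R]_3 -> R)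
    (s : 'rV[R]_3) : R :=
  'D_(basis_vec R i) (fun x => f (normalize x)) s.

Definition sphere_grad (R : realType) (f : 'rV[R]_3 -> R) (s : 'rV[R]_3)
    : 'rV[R]_3 :=
  \row_(i < 3) sphere_partial i f s.

Definition sphere_div (R : realType) (X : 'rV[R]_3 -> 'rV[R]_3)
    (s : 'rV[R]_3) : R :=
  \sum_(i < 3) sphere_partial i (fun x => X x 0 i) s.

Definition laplace_beltrami (R : realType) (f : 'rV[R]_3 -> R)
    (s : 'rV[R]_3) : R :=
  sphere_div (sphere_grad f) s.

(* The diagonal {v = w}, where [lifted_Q] is undefined, is left out; its
   complement is the set parametrized by (z, r, s) with r > 0.
   [is_derive] asserts that the time derivative exists. *)
Definition lifted_equation (R : realType) (alpha : R -> R)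
    (F : R -> 'rV[R]_3 * 'rV[R]_3 -> R) : Prop :=
  forall (t : R) (v w : 'rV[R]_3), 0 < t -> v <> w ->
    is_derive t (1 : R) (fun t' => F t' (v, w)) (lifted_Q alpha (F t) (v, w)).

Definition sphere_heat_equation (R : realType) (kappa : R)
    (u : R -> 'rV[R]_3 -> R) : Prop :=
  forall (t : R) (s : 'rV[R]_3), 0 < t -> unit_sphere s ->
    is_derive t (1 : R) (fun t' => u t' s) (kappa * laplace_beltrami (u t) s).

(* Main.v *)
(* Writing v = z + u and w = z - u, the operator d_v - d_w becomes the gradient
   in u, so Q is the divergence in u of 4 alpha(2|u|) (|u|^2 I - u u^T) grad.
   This matrix field annihilates the radial direction u, hence derivatives of
   alpha(2|u|) do not contribute, and at u = r s both sides reduce to the same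
   combination of first and second derivatives of u |-> F(z + u, z - u):
     r^2 sum_ij (delta_ij - s_i s_j) d_i d_j - 2 r sum_j s_j d_j. *)
Require Import Defs.
From HB Require Import structures.
From mathcomp Require Import all_boot all_order all_algebra.
From mathcomp Require Import all_classical all_reals all_analysis.
From mathcomp Require Import ring.
Import Order.TTheory GRing.Theory Num.Theory.
Import numFieldNormedType.Exports.

Set Implicit Arguments.
Unset Strict Implicit.
Unset Printing Implicit Defensive.

Local Open Scope classical_set_scope.
Local Open Scope ring_scope.

(** * Directional derivatives and chain rules *)

Lemma derive_along_line (R : numFieldType) (V W : normedModType R)
    (f : V -> W) (x v : V) :
  'D_v f x = 'D_1 (fun h : R => f (h *: v + x)) 0.
Proof.
rewrite /derive; set g1 := fun h => h^-1 *: _; set g2 := fun h => h^-1 *: _.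
suff -> : g1 = g2 by [].
by apply/funext => h; rewrite /g1 /g2 /= addr0 scale0r add0r [_%:A]mulr1.
Qed.

(** The inner map need only be derivable along [v]. Restricted to the line [h |-> h *: v + x] it has
    one scalar variable, where derivability is differentiability, so the differentials compose. *)
Lemma is_derive_comp_diff (R : numFieldType) (U V W : normedModType R)
    (f : U -> V) (g : V -> W) (x v : U) (w : V) :
  is_derive x v f w -> differentiable g (f x) ->
  is_derive x v (g \o f) ('D_w g (f x)).
Proof.
move=> [fxv <-] dg.
pose k (h : R) : V := f (h *: v + x).
have k0 : k 0 = f x by rewrite /k scale0r add0r.
have dk : differentiable k 0.
  by apply/derivable1_diffP; apply: (iffLR (derivable1P f x v)) fxv.
rewrite -k0 in dg *; have dgk : differentiable (g \o k) 0.
  exact: differentiable_comp.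
split; first by apply/(iffRL (derivable1P (g \o f) x v))/derivable1_diffP.
rewrite (derive_along_line f) (derive_along_line (g \o f)) -/k.
rewrite -[LHS]/('D_1 (g \o k) 0) (deriveE _ dgk) (deriveE _ dk).
by rewrite diff_comp //= -deriveE // k0.
Qed.

Lemma is_derive_comp1 (R : numFieldType) (V : normedModType R)
    (f : V -> R) (g : R -> R) (x v : V) (df dg : R) :
  is_derive x v f df -> is_derive (f x) 1 g dg ->
  is_derive x v (g \o f) (df * dg).
Proof.
move=> fxv [/derivable1_diffP gx <-].
apply: (is_derive_eq (is_derive_comp_diff fxv gx)); rewrite !deriveE //.
by rewrite -{1}[df]mulr1 -[df * 1]/(df *: (1 : R)) linearZ.
Qed.

Lemma is_derive_mx (R : realFieldType) (V : normedModType R) (m n : nat)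
    (M : V -> 'M[R]_(m, n)) (t v : V) (dM : 'M[R]_(m, n)) :
  (forall i j, is_derive t v (fun x => M x i j) (dM i j)) ->
  is_derive t v M dM.
Proof.
move=> dMij; have dMt : derivable M t v.
  by apply/derivable_mxP => i j; have [] := dMij i j.
split=> //; rewrite derive_mx //; apply/matrixP => i j; rewrite mxE.
by have [] := dMij i j.
Qed.

Lemma is_derive_coord (R : realFieldType) (m n : nat) (x v : 'M[R]_(m, n)) i j :
  is_derive x v (fun y => y i j) (v i j).
Proof.
have dx : forall i j, derivable (fun y : 'M[R]_(m, n) => y i j) x v.
  by move=> ? ?; apply/diff_derivable/differentiable_coord.
(* The value is read off entrywise from the derivative of the identity. *)
split=> //; have /derive_mx := @derivable_id R 'M[R]_(m, n) x v.
by rewrite derive_id => /matrixP/(_ i j); rewrite mxE => ->.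
Qed.

Lemma derive_rV (R : realFieldType) (n : nat) (W : normedModType R)
    (f : 'rV[R]_n -> W) (x v : 'rV[R]_n) :
  differentiable f x -> 'D_v f x = \sum_(k < n) v 0 k *: 'D_(delta_mx 0 k) f x.
Proof.
move=> df; rewrite deriveE // {1}(row_sum_delta v) linear_sum.
by apply: eq_bigr => k _; rewrite linearZ deriveE.
Qed.

(** * The Euclidean norm and its derivative away from the origin *)

Section EuclideanNorm.
Variables (R : realType) (n : nat).
Implicit Types x v : 'rV[R]_n.

Lemma enorm_ge0 x : 0 <= enorm x.
Proof. exact: sqrtr_ge0. Qed.

Lemma enorm_sqr x : enorm x ^+ 2 = \sum_(i < n) x 0 i ^+ 2.
Proof. by rewrite sqr_sqrtr // sumr_ge0 // => i _; rewrite sqr_ge0. Qed.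

Lemma enorm_gt0 x : (0 < enorm x) = (x != 0).
Proof.
rewrite lt_neqAle enorm_ge0 andbT eq_sym; congr (~~ _).
apply/eqP/eqP => [x0|->]; last first.
  by rewrite /enorm big1 ?sqrtr0 // => i _; rewrite mxE expr0n.
apply/rowP => i; rewrite mxE; apply/eqP; rewrite -sqrf_eq0; apply/eqP.
apply: (psumr_eq0P _ (_ : \sum_(i < n) x 0 i ^+ 2 = 0)) => // [j _|].
  by rewrite sqr_ge0.
by rewrite -enorm_sqr x0 expr0n.
Qed.

Lemma enormZ (c : R) x : 0 <= c -> enorm (c *: x) = c * enorm x.
Proof.
move=> c0; rewrite /enorm (eq_bigr (fun i => c ^+ 2 * x 0 i ^+ 2)).
  by rewrite -mulr_sumr sqrtrM ?sqr_ge0 // sqrtr_sqr ger0_norm.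
by move=> i _; rewrite mxE exprMn.
Qed.

(** Recasts the sum as one in the ring of functions, the form to which the differentiation rules for
    sums apply. *)
Lemma sum_sqr_coordE :
  (fun x => \sum_(i < n) x 0 i ^+ 2) =
  \sum_(i < n) (fun x : 'rV[R]_n => x 0 i) ^+ 2.
Proof. by apply/funext => x; rewrite fct_sumE. Qed.

Lemma differentiable_enorm x : x != 0 -> differentiable (@enorm R n) x.
Proof.
rewrite -enorm_gt0 => x0.
have -> : @enorm R n = Num.sqrt \o (fun y => \sum_(i < n) y 0 i ^+ 2) by [].
apply: differentiable_comp.
  rewrite sum_sqr_coordE; apply: differentiable_sum => i.
  exact/differentiableX/differentiable_coord.
have /is_derive1_sqrt[] : 0 < \sum_(i < n) x 0 i ^+ 2.
  by rewrite -enorm_sqr exprn_gt0.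
by move=> /derivable1_diffP.
Qed.

Lemma is_derive_enorm x v : x != 0 ->
  is_derive x v (@enorm R n) ((\sum_(i < n) x 0 i * v 0 i) / enorm x).
Proof.
rewrite -enorm_gt0 => x0.
have sx0 : 0 < \sum_(i < n) x 0 i ^+ 2 by rewrite -enorm_sqr exprn_gt0.
have S : is_derive x v (fun y => \sum_(i < n) y 0 i ^+ 2)
    (2 * \sum_(i < n) x 0 i * v 0 i).
  rewrite sum_sqr_coordE mulr_sumr; apply: is_derive_sum => i.
  apply: (is_derive_eq (is_deriveX 2 (is_derive_coord x v 0 i))).
  by rewrite /= expr1 mulrA.
apply: (is_derive_eq (is_derive_comp1 S (is_derive1_sqrt sx0))).
by rewrite -/(enorm x); field; rewrite gt_eqF.
Qed.
End EuclideanNorm.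

(** * Radial projection and tangential derivatives on the sphere *)

Section Sphere.
Variable R : realType.
Implicit Types (s x v : 'rV[R]_3) (f : 'rV[R]_3 -> R).

Lemma unit_sphere_neq0 s : unit_sphere s -> s != 0.
Proof. by move=> s1; rewrite -enorm_gt0 s1 ltr01. Qed.

Lemma normalize_unit x : x != 0 -> unit_sphere (normalize x).
Proof.
rewrite -enorm_gt0 => x0; rewrite /unit_sphere /= /normalize.
by rewrite enormZ ?invr_ge0 ?enorm_ge0 // mulVf // gt_eqF.
Qed.

Lemma normalize_id s : unit_sphere s -> normalize s = s.
Proof. by rewrite /normalize => ->; rewrite invr1 scale1r. Qed.

(** At a unit vector the derivative of [x |-> x / |x|] is the orthogonal projection onto the tangent
    plane: the factor [1 / |x|] has derivative [- <s, v>] there, which removes the normal component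
    of [v]. *)
Lemma is_derive_normalize s v : unit_sphere s ->
  is_derive s v (@normalize R) (v - (\sum_(k < 3) s 0 k * v 0 k) *: s).
Proof.
move=> s1; have s0 := unit_sphere_neq0 s1.
apply: is_derive_mx => i j; rewrite ord1.
have -> : (fun x => normalize x 0 j) =
    (fun x => (enorm x)^-1) * (fun x => x 0 j).
  by apply/funext => x; rewrite mxE.
have e0 : enorm s != 0 by rewrite s1 oner_eq0.
have dV : is_derive s v (fun x => (enorm x)^-1)
    (- (\sum_(k < 3) s 0 k * v 0 k)).
  have dinv : is_derive (enorm s) 1 (fun y : R => y^-1) (- enorm s ^- 2 *: 1).
    exact: (is_deriveV (f := id)).
  apply: (is_derive_eq (is_derive_comp1 (is_derive_enorm v s0) dinv)).
  by rewrite s1 expr1n invr1 scaleN1r mulrN1 mulr1.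
apply: (is_derive_eq (is_deriveM dV (is_derive_coord s v 0 j))).
by rewrite s1 invr1 scale1r !mxE scalerN /GRing.scale /= mulrC.
Qed.

(** Chain rule through the radial projection. It trades [normalize] for an ordinary derivative of
    [f] along the tangential part of the basis vector. *)
Lemma sphere_partial_tangent i f s : unit_sphere s -> differentiable f s ->
  sphere_partial i f s = 'D_(basis_vec R i - s 0 i *: s) f s.
Proof.
move=> s1 df; have ns := normalize_id s1.
have df' : differentiable f (normalize s) by rewrite ns.
have D := is_derive_comp_diff (is_derive_normalize (basis_vec R i) s1) df'.
have proj : basis_vec R i - (\sum_(k < 3) s 0 k * basis_vec R i 0 k) *: s =
    basis_vec R i - s 0 i *: s.
  congr (_ - _ *: _); rewrite (bigD1 i) //= big1 => [|k ki].
    by rewrite addr0 /basis_vec mxE !eqxx mulr1.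
  by rewrite /basis_vec mxE (negbTE ki) andbF mulr0.
by rewrite proj ns in D; case: D.
Qed.

(** Points near [s] are nonzero, so they project into the sphere, where the functions agree. A field
    known only on the sphere can thus be replaced by a convenient ambient extension before its
    divergence is taken. *)
Lemma sphere_partial_near i f g s : unit_sphere s ->
  (forall x, unit_sphere x -> f x = g x) ->
  sphere_partial i f s = sphere_partial i g s.
Proof.
move=> s1 fg; apply: near_eq_derive.
have : \forall x \near s, x != 0.
  by apply: (@cvgr_neq0 _ _ _ (nbhs s) _ id s) => //; exact: unit_sphere_neq0.
by apply: filterS => x x0; exact/fg/normalize_unit.
Qed.
End Sphere.

(** * The Laplace-Beltrami operator in Cartesian derivatives *)

(* Both sides differ by a multiple of 1 - |s|^2. *)
Lemma tangential_trace_id (R : comNzRingType) (s P : 'I_3 -> R)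
    (H v : 'I_3 -> 'I_3 -> R) :
  (forall i l, v i l = (l == i)%:R - s i * s l) ->
  \sum_(i < 3) s i ^+ 2 = 1 ->
  \sum_(i < 3)
    (\sum_(l < 3) v i l * H l i
     - (s i * \sum_(k < 3) (s k * (\sum_(l < 3) v i l * H l k) + v i k * P k)
        + v i i * \sum_(k < 3) s k * P k)) =
  \sum_(i < 3) H i i - \sum_(i < 3) \sum_(k < 3) s i * s k * H i k
    - 2 * \sum_(k < 3) s k * P k.
Proof.
move=> vE s1.
rewrite -[RHS]subr0 -[X in _ - X](mul0r (\sum_(i < 3) \sum_(k < 3)
  s i * s k * H i k + 2 * \sum_(k < 3) s k * P k)).
rewrite -[X in _ - X * _](subrr (\sum_(i < 3) s i ^+ 2)) {1}s1.
by rewrite !big_ord_recl !big_ord0 !vE /=; ring.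
Qed.

Section SphereLaplacian.
Variable R : realType.
Variable f : 'rV[R]_3 -> R.
Hypothesis df : forall x, differentiable f x.
Hypothesis dDf : forall k x, differentiable ('D_(basis_vec R k) f) x.

(** An extension of the components of the spherical gradient that is free of [normalize] and
    polynomial in the coordinates and first derivatives, hence open to the product rule. *)
Let tangential_partial (i : 'I_3) : 'rV[R]_3 -> R :=
  'D_(basis_vec R i) f -
  (fun x : 'rV[R]_3 => x 0 i) *
  \sum_(k < 3) (fun x : 'rV[R]_3 => x 0 k) * 'D_(basis_vec R k) f.

Let sphere_partialE i x : unit_sphere x ->
  sphere_partial i f x = tangential_partial i x.
Proof.
move=> x1; rewrite sphere_partial_tangent // deriveE // linearB linearZ.
rewrite -!deriveE // (derive_rV x (df x)).
by rewrite /tangential_partial !fctE fct_sumE.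
Qed.

Let derive_tangential_partial i x v :
  'D_v (tangential_partial i) x =
    'D_v ('D_(basis_vec R i) f) x -
     (x 0 i * \sum_(k < 3) (x 0 k * 'D_v ('D_(basis_vec R k) f) x
                            + v 0 k * 'D_(basis_vec R k) f x)
      + v 0 i * \sum_(k < 3) x 0 k * 'D_(basis_vec R k) f x).
Proof.
have dP k : is_derive x v ('D_(basis_vec R k) f)
    ('D_v ('D_(basis_vec R k) f) x).
  exact/derivableP/diff_derivable.
have dS := is_derive_sum (fun k => is_deriveM (is_derive_coord x v 0 k) (dP k)).
have [_ ->] := is_deriveB (dP i) (is_deriveM (is_derive_coord x v 0 i) dS).
rewrite /= fct_sumE /GRing.scale /=; congr (_ - (_ * _ + _)).
  by apply: eq_bigr => k _; rewrite [X in _ + X]mulrC.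
by rewrite mulrC.
Qed.

Let differentiable_tangential_partial i x :
  differentiable (tangential_partial i) x.
Proof.
apply: differentiableB => //; apply: differentiableM.
  exact: differentiable_coord.
by apply: differentiable_sum => k; apply: differentiableM => //;
  exact: differentiable_coord.
Qed.

(** This is the trace of the Hessian minus its normal-normal entry minus twice the normal
    derivative; the 2 is the sum of the principal curvatures of the unit sphere. *)
Lemma laplace_beltramiE s : unit_sphere s ->
  laplace_beltrami f s =
    \sum_(i < 3) 'D_(basis_vec R i) ('D_(basis_vec R i) f) s
    - \sum_(i < 3) \sum_(k < 3)
        s 0 i * s 0 k * 'D_(basis_vec R i) ('D_(basis_vec R k) f) s
    - 2 * \sum_(k < 3) s 0 k * 'D_(basis_vec R k) f s.
Proof.
move=> s1; rewrite /laplace_beltrami /sphere_div.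
under eq_bigr => i _.
  rewrite (sphere_partial_near i (g := tangential_partial i) s1); last first.
    by move=> x x1; rewrite mxE sphere_partialE.
  rewrite sphere_partial_tangent //.
  rewrite derive_tangential_partial.
  (* Derivatives along the projected direction are expanded in the basis, so that only Hessian
     entries remain for the trace identity. *)
  rewrite (derive_rV _ (dDf i s)).
  under [X in _ * X + _]eq_bigr => k _ do rewrite (derive_rV _ (dDf k s)).
  over.
apply: (@tangential_trace_id R (s 0) (fun k => 'D_(basis_vec R k) f s)
  (fun i k => 'D_(basis_vec R i) ('D_(basis_vec R k) f) s)
  (fun i l => (basis_vec R i - s 0 i *: s) 0 l)).
  by move=> i l; rewrite !mxE.
by rewrite -enorm_sqr s1 expr1n.
Qed.
End SphereLaplacian.

(** * Relative derivatives and the change of variables *)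

Lemma is_derive_affine (R : numFieldType) (V W : normedModType R)
    (f : V -> W) (x v : V) (w : W) :
  (forall h : R, f (h *: v + x) = h *: w + f x) -> is_derive x v f w.
Proof.
move=> fE.
have E : (fun h : R => f (h *: v + x)) = *:%R^~ w + cst (f x).
  exact/funext.
have D : is_diff (0 : R) ( *:%R^~ w + cst (f x)) ( *:%R^~ w : R -> W).
  by apply: is_diff_eq (addr0 _).
split.
  by apply/(iffRL (derivable1P f x v)); rewrite E; apply/derivable1_diffP.
by rewrite derive_along_line E deriveE // diff_val scale1r.
Qed.

Section LiftedVariables.
Variable R : realType.
Implicit Types (F G : 'rV[R]_3 * 'rV[R]_3 -> R) (p : 'rV[R]_3 * 'rV[R]_3).

(** By linearity of the differential, the difference of partials is one derivative along
    [(e_i, - e_i)]. *)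
Lemma partial_vwE i F p : differentiable F p ->
  partial_vw i F p = 'D_(basis_vec R i, - basis_vec R i) F p.
Proof.
move=> dF; rewrite /partial_vw /partial_v /partial_w !deriveE // -linearB.
by congr ('d F p (_, _)); rewrite /= ?subr0 ?sub0r.
Qed.

Lemma differentiable_sub_pair p :
  differentiable (fun q : 'rV[R]_3 * 'rV[R]_3 => q.1 - q.2) p.
Proof.
apply: differentiableB; apply: linear_differentiable.
  by move=> q; exact: cvg_fst.
by move=> q; exact: cvg_snd.
Qed.

Lemma is_derive_sub_pair p (v w : 'rV[R]_3) :
  is_derive p (v, w) (fun q : 'rV[R]_3 * 'rV[R]_3 => q.1 - q.2) (v - w).
Proof.
by apply: is_derive_affine => h /=; rewrite scalerBr opprD addrACA.
Qed.

Lemma differentiable_bar F z r s : differentiable F (z + r *: s, z - r *: s) ->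
  differentiable (bar F z r) s.
Proof.
move=> dF.
have -> : bar F z r = F \o (fun x => (z + r *: x, z - r *: x)) by [].
exact: differentiable_comp.
Qed.

(** Moving [s] along [e_i] moves the pair along [r (e_i, - e_i)], hence the factor [r]. *)
Lemma derive_bar F z r s i : differentiable F (z + r *: s, z - r *: s) ->
  'D_(basis_vec R i) (bar F z r) s = r * bar (partial_vw i F) z r s.
Proof.
move=> dF; rewrite /bar partial_vwE //.
have D : is_derive s (basis_vec R i) (fun x => (z + r *: x, z - r *: x))
    (r *: (basis_vec R i, - basis_vec R i)).
  apply: is_derive_affine => h.
  congr (_, _); rewrite /= scalerDr !scalerA mulrC.
    by rewrite addrCA.
  by rewrite opprD addrCA scalerN.
have [_] := is_derive_comp_diff D dF.
rewrite /comp => ->; rewrite !deriveE //.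
by rewrite linearZ.
Qed.
End LiftedVariables.

(** * Derivatives of the Landau coefficients *)

Section Coefficients.
Variables (R : realType) (alpha : R -> R) (i j : 'I_3) (y : 'rV[R]_3).
Hypothesis y0 : y != 0.
Hypothesis dalpha : derivable alpha (enorm y) 1.

Let a_coefE : a_coef alpha i j = (alpha \o @enorm R 3) *
  ((i == j)%:R *: (@enorm R 3 ^+ 2) -
   (fun x : 'rV[R]_3 => x 0 i) * (fun x : 'rV[R]_3 => x 0 j)).
Proof.
by apply/funext => x; rewrite /a_coef !fctE /GRing.scale /= [X in X - _]mulrC.
Qed.

Lemma differentiable_a_coef : differentiable (a_coef alpha i j) y.
Proof.
have de := differentiable_enorm y0.
rewrite a_coefE; apply: differentiableM.
  by apply: differentiable_comp => //; exact/derivable1_diffP.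
apply: differentiableB; first exact/differentiableZ/differentiableX.
by apply: differentiableM; exact: differentiable_coord.
Qed.

(** Product rule: the first summand differentiates the potential, [yv / enorm y] being the
    derivative of the norm, and the second the quadratic factor. *)
Lemma derive_a_coef (v : 'rV[R]_3) :
  let yv := \sum_(k < 3) y 0 k * v 0 k in
  'D_v (a_coef alpha i j) y =
    yv / enorm y * 'D_1 alpha (enorm y)
      * (enorm y ^+ 2 * (i == j)%:R - y 0 i * y 0 j)
    + alpha (enorm y)
      * (2 * yv * (i == j)%:R - (y 0 i * v 0 j + v 0 i * y 0 j)).
Proof.
move=> yv; have e0 : enorm y != 0 by rewrite gt_eqF ?enorm_gt0.
have de := is_derive_enorm v y0.
have Dcoord k := is_derive_coord y v 0 k.
have [_] := is_deriveM (is_derive_comp1 de (derivableP dalpha))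
  (is_deriveB (is_deriveZ (i == j)%:R (is_deriveX 2 de))
              (is_deriveM (Dcoord i) (Dcoord j))).
rewrite -a_coefE => ->; rewrite !fctE /GRing.scale /= -/yv.
have -> : (i == j)%:R *: enorm y ^+ 2 = (i == j)%:R * enorm y ^+ 2 by [].
by field.
Qed.
End Coefficients.

(** * The lifted operator in the new coordinates *)

Lemma relative_velocityE (R : pzRingType) (V : lmodType R)
    (z : V) (r : R) (s : V) :
  z + r *: s - (z - r *: s) = (2 * r) *: s.
Proof. by rewrite opprB addrCA [z + _]addrC addrK mulr_natl mulr2n scalerDl. Qed.

Section LiftedOperator.
Variables (R : realType) (alpha : R -> R).
Hypothesis dalpha : forall r : R, 0 < r -> derivable alpha r 1.

(** Leibniz rule. The direction [e_k - - e_k], that is [2 e_k], is the image of [(e_k, - e_k)] under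
    [q |-> q.1 - q.2]. *)
Lemma partial_vw_a_coefM (i j k : 'I_3) (G : 'rV[R]_3 * 'rV[R]_3 -> R) p :
  p.1 - p.2 != 0 -> differentiable G p ->
  partial_vw k (fun q => a_coef alpha i j (q.1 - q.2) * G q) p =
    a_coef alpha i j (p.1 - p.2) * partial_vw k G p
    + G p * 'D_(basis_vec R k - - basis_vec R k) (a_coef alpha i j) (p.1 - p.2).
Proof.
move=> p0 dG.
have da : differentiable (a_coef alpha i j) (p.1 - p.2).
  by apply: differentiable_a_coef => //; apply: dalpha; rewrite enorm_gt0.
have dad : differentiable
    (a_coef alpha i j \o (fun q : 'rV[R]_3 * 'rV[R]_3 => q.1 - q.2)) p.
  by apply: differentiable_comp => //; exact: differentiable_sub_pair.
have D := is_derive_comp_diff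
  (is_derive_sub_pair p (basis_vec R k) (- basis_vec R k)) da.
rewrite !partial_vwE //; last exact: differentiableM dad dG.
have DG : is_derive p (basis_vec R k, - basis_vec R k) G
    ('D_(basis_vec R k, - basis_vec R k) G p).
  exact/derivableP/diff_derivable.
by have [_] := is_deriveM D DG.
Qed.

(* The radial derivative [a'] of the potential drops out because its coefficient
   is a multiple of 1 - |s|^2. *)
Lemma landau_trace_id (s P : 'I_3 -> R) (H e : 'I_3 -> 'I_3 -> R) (r a a' : R) :
  r != 0 -> (forall i k, e i k = (k == i)%:R) -> \sum_(i < 3) s i ^+ 2 = 1 ->
  \sum_(i < 3) \sum_(j < 3)
    (a * ((2 * r) ^+ 2 * (i == j)%:R - 2 * r * s i * (2 * r * s j)) * H i j
     + P j * ((\sum_(k < 3) 2 * r * s k * (e i k + e i k)) / (2 * r) * a'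
       * ((2 * r) ^+ 2 * (i == j)%:R - 2 * r * s i * (2 * r * s j))
     + a * (2 * (\sum_(k < 3) 2 * r * s k * (e i k + e i k)) * (i == j)%:R
       - (2 * r * s i * (e i j + e i j) + (e i i + e i i) * (2 * r * s j))))) =
  4 * a * (\sum_(i < 3) r * (r * H i i)
    - \sum_(i < 3) \sum_(k < 3) s i * s k * (r * (r * H i k))
    - 2 * \sum_(k < 3) s k * (r * P k)).
Proof.
move=> r0 eE s1.
rewrite -[RHS]addr0.
rewrite -[X in _ + X](mul0r (8 * r ^+ 2 * a' * \sum_(k < 3) s k * P k)).
rewrite -[X in _ + X * _](subrr (\sum_(i < 3) s i ^+ 2)) {1}s1.
by rewrite !big_ord_recl !big_ord0 !eE /=; field.
Qed.

Lemma bar_lifted_Q (F : 'rV[R]_3 * 'rV[R]_3 -> R) z r s :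
  Ck 2 F -> 0 < r -> unit_sphere s ->
  bar (lifted_Q alpha F) z r s =
    4 * alpha (2 * r) * laplace_beltrami (bar F z r) s.
Proof.
move=> [dF CDF] r0 s1.
have dDF v p : differentiable ('D_v F) p by have [] := CDF v.

(* Stated as an equality of functions, so that it can be differentiated again; second derivatives
   then carry [r ^+ 2]. *)
have dbar G : (forall p, differentiable G p) -> forall i,
    'D_(basis_vec R i) (bar G z r) = r \*: bar (partial_vw i G) z r.
  by move=> dG i; apply/funext => x; rewrite derive_bar.
have dvw i p : differentiable (partial_vw i F) p.
  have -> : partial_vw i F = 'D_(basis_vec R i, - basis_vec R i) F.
    by apply/funext => q; rewrite partial_vwE.
  exact: dDF.
have dbvw i x : differentiable (bar (partial_vw i F) z r) x.
  exact: differentiable_bar.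
have dbarF k x : differentiable ('D_(basis_vec R k) (bar F z r)) x.
  by rewrite dbar //; exact: differentiableZ.
have D2 i k : 'D_(basis_vec R i) ('D_(basis_vec R k) (bar F z r)) s =
    r * (r * bar (partial_vw i (partial_vw k F)) z r s).
  rewrite dbar // deriveZ; last exact: diff_derivable.
  by rewrite derive_bar.
(* First and second relative derivatives are the common unknowns in which both sides are written. *)
pose P k := bar (partial_vw k F) z r s.
pose H i k := bar (partial_vw i (partial_vw k F)) z r s.
have -> : laplace_beltrami (bar F z r) s =
    \sum_(i < 3) r * (r * H i i)
    - \sum_(i < 3) \sum_(k < 3) s 0 i * s 0 k * (r * (r * H i k))
    - 2 * \sum_(k < 3) s 0 k * (r * P k).
  rewrite laplace_beltramiE //; last by move=> x; exact: differentiable_bar.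
  congr (_ - _ - 2 * _); apply: eq_bigr => i _; first by rewrite D2.
    by apply: eq_bigr => k _; rewrite D2.
  by rewrite derive_bar.
have y_eq := relative_velocityE z r s.
have y_norm : enorm ((2 * r) *: s) = 2 * r.
  by rewrite enormZ ?mulr_ge0 ?(ltW r0) // s1 mulr1.
have y_neq0 : (2 * r) *: s != 0.
  by rewrite -enorm_gt0 y_norm mulr_gt0.
(* Basis coordinates stay symbolic in [e], matching the sums that differentiating the coefficients
   produces. *)
rewrite -(@landau_trace_id (s 0) P H (fun i k => basis_vec R i 0 k) r
  (alpha (2 * r)) ('D_1 alpha (2 * r))) ?gt_eqF //; first last.
- by rewrite -enorm_sqr s1 expr1n.
- by move=> i k; rewrite mxE.
rewrite {1}/bar /lifted_Q; apply: eq_bigr => i _; apply: eq_bigr => j _.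
rewrite partial_vw_a_coefM ?y_eq //.
rewrite derive_a_coef ?y_norm //; last by apply: dalpha; rewrite mulr_gt0.
rewrite /a_coef y_norm opprK !mxE.
by under eq_bigr do rewrite !mxE; under [in RHS]eq_bigr do rewrite !mxE.
Qed.
End LiftedOperator.

(** * Covering the off-diagonal pairs, and the heat equation *)

Lemma sphere_coordinates (R : realType) (v w : 'rV[R]_3) : v != w ->
  exists z r s, [/\ 0 < r, unit_sphere s, v = z + r *: s & w = z - r *: s].
Proof.
rewrite -subr_eq0 => vw0; have e0 := vw0; rewrite -enorm_gt0 in e0.
(* Midpoint, half the distance, and direction of [v - w]. *)
exists (2^-1 *: (v + w)), (2^-1 * enorm (v - w)), (normalize (v - w)).
have -> : (2^-1 * enorm (v - w)) *: normalize (v - w) = 2^-1 *: (v - w).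
  by rewrite scalerA mulfK // gt_eqF.
split; first by rewrite mulr_gt0 ?invr_gt0.
- exact: normalize_unit.
- by apply/rowP => i; rewrite !mxE; field.
- by apply/rowP => i; rewrite !mxE; field.
Qed.

(** Since [v - w = 2 r s], the potential is evaluated at [2 * r] and the quadratic matrix
    contributes 4, so the coefficient is [4 * alpha (2 * r)] rather than [alpha r]. The equations
    are equivalent because the coordinates with [r > 0] cover exactly the pairs with [v <> w]. *)
Theorem lemma4 (R : realType) (alpha : R -> R)
    (alpha_ge0 : forall r : R, 0 < r -> 0 <= alpha r)
    (alpha_diff : forall r : R, 0 < r -> derivable alpha r 1) :
  (forall F : 'rV[R]_3 * 'rV[R]_3 -> R, Ck 2 F ->
     forall (z : 'rV[R]_3) (r : R) (s : 'rV[R]_3),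
       0 < r -> unit_sphere s ->
       bar (lifted_Q alpha F) z r s
         = 4 * alpha (2 * r) * laplace_beltrami (bar F z r) s)
  /\
  (forall F : R -> 'rV[R]_3 * 'rV[R]_3 -> R,
     (forall t : R, 0 < t -> Ck 2 (F t)) ->
     (lifted_equation alpha F <->
      forall (z : 'rV[R]_3) (r : R), 0 < r ->
        sphere_heat_equation (4 * alpha (2 * r)) (fun t => bar (F t) z r))).
Proof.
have barQ := bar_lifted_Q alpha_diff.
split=> [F CF z r s r0 s1|F CF]; first exact: barQ.
split=> [LE z r r0 t s t0 s1|HE t v w t0 /eqP].
  rewrite -barQ //; last exact: CF.
  (* The point is off the diagonal because [2 r s] is nonzero. *)
  apply: LE => // /eqP; rewrite -subr_eq0 relative_velocityE.
  by apply/negP; rewrite scaler_eq0 negb_or mulf_neq0 ?gt_eqF ?unit_sphere_neq0.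
move=> /sphere_coordinates[z [r [s [r0 s1 -> ->]]]].
by have := HE z r r0 t s t0 s1; rewrite -barQ //; exact: CF.
Qed.
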